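(* Let $\gamma=\{\gamma(n)\}_{n=0,1,2,\dots}$ be a sequence of positive numbers with $\inf_n\gamma(n)>0$. If $$\liminf_{n\to\infty}\frac{\gamma(n)}{\log n}=0,$$ then there exist two real-valued functions $f$ and $g$ on $\mathbb T$ such that $f\in A_\gamma(\mathbb T)$ and $g\in V(\mathbb T)\cap C(\mathbb T)$ but $fg\notin U(\mathbb T)$.
   Context: $\mathbb T=\mathbb R/(2\pi\mathbb Z)$; functions on $\mathbb T$ are identified with $2\pi$-periodic functions on $\mathbb R$. $C(\mathbb T)$ is the space of continuous (complex-valued) functions on $\mathbb T$ with the sup norm. Fourier coefficients: $\widehat f(k)=\frac1{2\pi}\int_{\mathbb T}f(t)e^{-ikt}dt$, and $S_N(f)(t)=\sum_{|k|\le N}\widehat f(k)e^{ikt}$. $U(\mathbb T)$ is the space of all $f\in C(\mathbb T)$ such that $\|f-S_N(f)\|_{C(\mathbb T)}\to0$ as $N\to\infty$. $A_\gamma(\mathbb T)$ is the space of all $f\in C(\mathbb T)$ with $\sum_{k\in\mathbb Z}|\widehat f(k)|\gamma(|k|)<\infty$. $V(\mathbb T)$ is the space of functions of bounded variation on $\mathbb T$. *)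

(* Defs.v *)
From Stdlib Require Export Reals ZArith.
From Coquelicot Require Export Coquelicot.
Open Scope R_scope.

(* A function on the circle T = R/(2 pi Z) is a 2 pi-periodic function
   R -> C; a real-valued one is post-composed with RtoC. *)
Definition periodic_T (f : R -> C) : Prop :=
  forall t : R, f (t + 2 * PI) = f t.

(* C(T) *)
Definition in_CT (f : R -> C) : Prop :=
  periodic_T f /\ forall t : R, continuous (U := C_UniformSpace) f t.

(* Valued in Rbar, so that an unbounded h has norm p_infty. *)
Definition sup_norm (h : R -> C) : Rbar :=
  Lub_Rbar (fun x : R => exists t : R, x = Cmod (h t)).

(* e^{i theta} *)
Definition expi (theta : R) : C := (cos theta, sin theta).

Definition fourier_coef (f : R -> C) (k : Z) : C :=
  (RtoC (/ (2 * PI)) *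
   RInt (V := C_R_CompleteNormedModule)
     (fun t : R => f t * expi (- IZR k * t)) 0 (2 * PI))%C.

(* The sum of F k over the integers k with |k| <= N, via k = j - N for
   0 <= j <= 2 N (the bound of sum_n is inclusive). *)
Definition sum_sym {G : AbelianMonoid} (F : Z -> G) (N : nat) : G :=
  sum_n (fun j : nat => F (Z.of_nat j - Z.of_nat N)%Z) (2 * N).

Definition fourier_sum (f : R -> C) (N : nat) (t : R) : C :=
  sum_sym (G := C_AbelianMonoid)
    (fun k : Z => (fourier_coef f k * expi (IZR k * t))%C) N.

(* U(T) *)
Definition in_UT (f : R -> C) : Prop :=
  in_CT f /\
  forall eps : R, 0 < eps ->
    exists N0 : nat, forall N : nat, (N0 <= N)%nat ->
      Rbar_lt (sup_norm (fun t : R => (f t - fourier_sum f N t)%C)) eps.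

(* A_gamma(T).  The terms are nonnegative whenever gamma is, so convergence of
   the symmetric partial sums is summability over Z. *)
Definition in_AT (gamma : nat -> R) (f : R -> C) : Prop :=
  in_CT f /\
  ex_finite_lim_seq
    (sum_sym (fun k : Z => Cmod (fourier_coef f k) * gamma (Z.abs_nat k))).

(* V(T): the variations over all partitions x 0 <= ... <= x (S n) inside a
   period are bounded. *)
Definition in_VT (f : R -> C) : Prop :=
  periodic_T f /\
  exists M : R, forall (n : nat) (x : nat -> R),
    0 <= x 0%nat -> x (S n) <= 2 * PI ->
    (forall i : nat, (i <= n)%nat -> x i <= x (S i)) ->
    sum_n (fun i : nat => Cmod (f (x (S i)) - f (x i))%C) n <= M.

(* Main.v *)
(* Let F_M be the Fejer mean of order M + 2 of the sawtooth (PI - t) / 2.  Its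
   derivative plus 1/2 is half a Fejer kernel, so F_M + t / 2 is nondecreasing;
   hence both |F_M| and its variation over a period are bounded independently
   of M, while its sine coefficients are nonnegative and have sum at least
   ln (M + 2) - 1.

   Choose n_j with gamma(n_j) <= 4^-j ln n_j and ln n_j >= 2 * 4^j, and put
     f = sum_j (2^j / ln n_j) sin(n_j t),   g = sum_j 2^-j F_{n_j}(t).
   For n, p >= 1, S_N(sin(n.) sin(p.))(0) = ([|n - p| <= N] - [n + p <= N]) / 2
   is nonnegative, and equals 1/2 if N = n and p <= 2n.  No term of the double
   series for f g thus contributes negatively to S_{n_j}(f g)(0), and the
   diagonal term alone contributes at least
   (1 / ln n_j) (ln n_j - 1) / 2 >= 1/4, although f(0) g(0) = 0. *)

Require Import Defs.
From Stdlib Require Import Lra Lia IndefiniteDescription.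

(** * Symmetric sums and geometrically convergent series *)

(** The window is indexed from its left end, so enlarging it shifts the index of every old term;
    peeling one term off each end realigns the two sums. *)
Lemma sum_sym_S (F : Z -> R) (N : nat) :
  (sum_sym F (S N) : R) = sum_sym F N + F (Z.of_nat (S N)) + F (- Z.of_nat (S N))%Z.
Proof.
unfold sum_sym; rewrite !sum_n_Reals.
replace (2 * S N)%nat with (S (S (2 * N))) by lia.
rewrite decomp_sum by lia; cbn [Init.Nat.pred].
rewrite tech5.
rewrite (sum_eq (fun i => F (Z.of_nat (S i) - Z.of_nat (S N))%Z)
  (fun i => F (Z.of_nat i - Z.of_nat N)%Z)) by (intros; f_equal; lia).
replace (Z.of_nat 0 - Z.of_nat (S N))%Z with (- Z.of_nat (S N))%Z by lia.
replace (Z.of_nat (S (S (2 * N))) - Z.of_nat (S N))%Z with (Z.of_nat (S N)) by lia.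
ring.
Qed.

Lemma sum_sym_O (F : Z -> R) : (sum_sym F 0 : R) = F 0%Z.
Proof. unfold sum_sym. now rewrite sum_O. Qed.

Lemma sum_sym_le (F G : Z -> R) (N : nat) :
  (forall k, F k <= G k) -> sum_sym F N <= sum_sym G N.
Proof.
intros H; induction N as [|N IH].
- rewrite !sum_sym_O; apply H.
- rewrite !sum_sym_S.
  generalize (H (Z.of_nat (S N))) (H (- Z.of_nat (S N))%Z); lra.
Qed.

Lemma sum_sym_plus (F G : Z -> R) (N : nat) :
  (sum_sym (fun k => F k + G k) N : R) = sum_sym F N + sum_sym G N.
Proof.
induction N as [|N IH].
- now rewrite !sum_sym_O.
- rewrite !sum_sym_S, IH; ring.
Qed.

Lemma sum_sym_scal (c : R) (F : Z -> R) (N : nat) :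
  (sum_sym (fun k => c * F k) N : R) = c * sum_sym F N.
Proof.
induction N as [|N IH].
- now rewrite !sum_sym_O.
- rewrite !sum_sym_S, IH; ring.
Qed.

Lemma sum_sym_ext (F G : Z -> R) (N : nat) :
  (forall k, F k = G k) -> sum_sym F N = sum_sym G N.
Proof.
intros H; apply Rle_antisym; apply sum_sym_le; intros k; rewrite H; apply Rle_refl.
Qed.

Lemma sum_sym_sum (u : nat -> Z -> R) (J N : nat) :
  (sum_sym (fun k => sum_f_R0 (fun i => u i k) J) N : R)
  = sum_f_R0 (fun i => sum_sym (u i) N) J.
Proof.
induction J as [|J IH]; simpl; [reflexivity|].
now rewrite <- IH, <- sum_sym_plus.
Qed.

Lemma sum_f_R0_ge_term (u : nat -> R) (n j : nat) :
  (forall i, 0 <= u i) -> (j <= n)%nat -> u j <= sum_f_R0 u n.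
Proof.
intros H Hj; induction n as [|n IH].
- replace j with 0%nat by lia; simpl; lra.
- simpl; destruct (Nat.eq_dec j (S n)) as [->|Hn].
  + generalize (cond_pos_sum u n H); lra.
  + generalize (IH ltac:(lia)) (H (S n)); lra.
Qed.

Lemma sum_half_pow (J : nat) : sum_f_R0 (fun j => (/ 2) ^ j) J = 2 - (/ 2) ^ J.
Proof.
induction J as [|J IH]; simpl in *; [|rewrite IH]; lra.
Qed.

Lemma half_pow_small (C eps : R) :
  0 < eps -> exists J0 : nat, forall J, (J0 <= J)%nat -> C * (/ 2) ^ J < eps.
Proof.
intros He.
destruct (pow_lt_1_zero (/ 2) ltac:(rewrite Rabs_right; lra) (eps / (Rabs C + 1))) as [J0 H].
- apply Rdiv_lt_0_compat; [lra|generalize (Rabs_pos C); lra].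
- exists J0; intros J HJ; specialize (H J HJ).
  assert (Hp : 0 < (/ 2) ^ J) by (apply pow_lt; lra).
  rewrite Rabs_right in H by lra.
  generalize (Rabs_pos C) (Rle_abs C); intros.
  apply Rle_lt_trans with ((Rabs C + 1) * (/ 2) ^ J); [nra|].
  apply Rmult_lt_compat_l with (r := Rabs C + 1) in H; [|lra].
  replace ((Rabs C + 1) * (eps / (Rabs C + 1))) with eps in H by (field; lra).
  exact H.
Qed.

(** Stands in for passages to the limit, since every truncation error below has the form
    [C * (/ 2) ^ J]. The threshold [j] serves estimates valid only once the truncation contains the
    term of index [j]. *)
Lemma le_of_half_pow (a b C : R) (j : nat) :
  (forall J, (j <= J)%nat -> a <= b + C * (/ 2) ^ J) -> a <= b.
Proof.
intros H; apply Rnot_lt_le; intros Hlt.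
destruct (half_pow_small C (a - b) ltac:(lra)) as [J0 HJ].
generalize (HJ (max J0 j) ltac:(lia)) (H (max J0 j) ltac:(lia)); lra.
Qed.

(** The tail starts at [S J], and the powers of 1/2 from there on sum to exactly [(/ 2) ^ J], so the
    constant [C] is preserved. *)
Lemma Series_half_pow_tail (u : nat -> R) (C : R) (J : nat) :
  (forall j, Rabs (u j) <= C * (/ 2) ^ j) ->
  Rabs (Series u - sum_f_R0 u J) <= C * (/ 2) ^ J.
Proof.
intros H.
assert (Hg : ex_series (fun j => C * (/ 2) ^ j)).
{ apply (ex_series_scal_l (K := R_AbsRing) C (fun j => (/ 2) ^ j)).
  exists (/ (1 - / 2)); apply is_series_geom; rewrite Rabs_right; lra. }
assert (Hu : ex_series (fun j => Rabs (u j))).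
{ apply (ex_series_le (K := R_AbsRing) (V := R_CompleteNormedModule)) with (2 := Hg).
  intros n; unfold norm; simpl; unfold abs; simpl; rewrite Rabs_Rabsolu; apply H. }
assert (Hs := ex_series_Rabs _ Hu).
rewrite (Series_incr_n u (S J)) by (lia || assumption).
simpl pred.
replace (sum_f_R0 u J + Series (fun k => u (S J + k)%nat) - sum_f_R0 u J)
  with (Series (fun k => u (S J + k)%nat)) by ring.
eapply Rle_trans; [apply Series_Rabs; now apply (ex_series_incr_n (fun j => Rabs (u j)) (S J))|].
eapply Rle_trans.
- apply Series_le with (b := fun k => C * (/ 2) ^ S J * (/ 2) ^ k).
  + intros n; split; [apply Rabs_pos|].
    eapply Rle_trans; [apply H|].
    rewrite pow_add; right; ring.
  + apply (ex_series_scal_l (K := R_AbsRing) (C * (/ 2) ^ S J) (fun j => (/ 2) ^ j)).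
    exists (/ (1 - / 2)); apply is_series_geom; rewrite Rabs_right; lra.
- rewrite Series_scal_l, Series_geom by (rewrite Rabs_right; lra).
  simpl; right; field.
Qed.

Lemma continuous_half_pow_limit (u : nat -> R -> R) (F : R -> R) (C : R) :
  (forall j t, continuous (u j) t) ->
  (forall J t, Rabs (F t - u J t) <= C * (/ 2) ^ J) ->
  forall t, continuous F t.
Proof.
intros Hu HF t.
apply continuity_pt_filterlim.
intros eps He.
destruct (half_pow_small C (eps / 3) ltac:(lra)) as [J HJ].
specialize (HJ J (le_n J)).
assert (Hc := Hu J t); apply continuity_pt_filterlim in Hc.
destruct (Hc (eps / 3) ltac:(lra)) as [d [Hd Hx]].
exists d; split; [exact Hd|].
intros x Hx'; specialize (Hx x Hx'); simpl in *; unfold Rdist in *.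
generalize (HF J t) (HF J x).
unfold Rabs in *; repeat destruct Rcase_abs; lra.
Qed.

(** * The Fejer mean of the sawtooth *)

(** The subtraction formula turns the left side into a sum of cos((n + 1 - k) t), which is then read
    backwards. It is the cross term that arises when one more exponential enters the square in
    [fejer_square]. *)
Lemma dirichlet_reverse (n : nat) (t : R) :
  sum_f_R0 (fun k => cos (INR k * t)) n * cos (INR (S n) * t)
  + sum_f_R0 (fun k => sin (INR k * t)) n * sin (INR (S n) * t)
  = sum_f_R0 (fun i => cos (INR (S i) * t)) n.
Proof.
assert (Hrev : forall (phi : nat -> R) m,
  sum_f_R0 (fun k => phi (S m - k)%nat) m = sum_f_R0 (fun i => phi (S i)) m).
{ intros phi m; induction m as [|m IH]; [reflexivity|].
  rewrite decomp_sum by lia; cbn [Init.Nat.pred].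
  rewrite tech5, <- IH; cbn [Nat.sub]; ring. }
rewrite <- (Hrev (fun i => cos (INR i * t)) n).
rewrite 2 (Rmult_comm (sum_f_R0 _ _)), 2 scal_sum, <- sum_plus.
apply sum_eq; intros k Hk.
rewrite (minus_INR (S n) k) by lia.
rewrite Rmult_minus_distr_r, cos_minus; ring.
Qed.

(** Both sides are M + 2 times the Fejer kernel; the right one is the squared modulus of the sum of
    e^{ikt} over 0 <= k <= M + 1. In the induction the new exponential adds 1 plus twice the cross
    term. *)
Lemma fejer_square (M : nat) (t : R) :
  INR (S (S M))
  + 2 * sum_f_R0 (fun i => (INR (S (S M)) - INR (S i)) * cos (INR (S i) * t)) M
  = (sum_f_R0 (fun k => cos (INR k * t)) (S M))²
    + (sum_f_R0 (fun k => sin (INR k * t)) (S M))².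
Proof.
unfold Rsqr; induction M as [|M IH].
- cbn [sum_f_R0]; replace (INR 0 * t) with 0 by (simpl; ring).
  rewrite cos_0, sin_0.
  generalize (sin2_cos2 (INR 1 * t)); unfold Rsqr; simpl; intros; nra.
- rewrite !(tech5 _ (S M)).
  assert (HD := dirichlet_reverse (S M) t).
  assert (H1 := sin2_cos2 (INR (S (S M)) * t)); unfold Rsqr in H1.
  rewrite (tech5 (fun i => cos (INR (S i) * t))) in HD.
  rewrite (tech5 (fun i => (INR (S (S (S M))) - INR (S i)) * cos (INR (S i) * t))).
  rewrite (sum_eq _ (fun i => (INR (S (S M)) - INR (S i)) * cos (INR (S i) * t)
    + cos (INR (S i) * t))) by (intros; rewrite (S_INR (S (S M))); ring).
  rewrite sum_plus.
  cbv beta; rewrite (S_INR (S (S M))) in *.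
  lra.
Qed.

(** The sawtooth has sine coefficients 1/m; the Fejer weight 1 - m/(M + 2) turns them into 1/m -
    1/(M + 2), for m = [S i] from 1 to M + 1. *)
Definition fejer_sawtooth (M : nat) (t : R) : R :=
  sum_f_R0 (fun i => (/ INR (S i) - / INR (S (S M))) * sin (INR (S i) * t)) M.

Lemma is_derive_fejer_sawtooth (M : nat) (t : R) :
  is_derive (fejer_sawtooth M) t
    (sum_f_R0 (fun i => (1 - INR (S i) / INR (S (S M))) * cos (INR (S i) * t)) M).
Proof.
unfold fejer_sawtooth.
apply (is_derive_ext
  (fun y => sum_n (fun i => (/ INR (S i) - / INR (S (S M))) * sin (INR (S i) * y)) M)).
{ intros; apply sum_n_Reals. }
rewrite <- sum_n_Reals.
apply (is_derive_sum_n (K := R_AbsRing) (V := R_NormedModule)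
  (fun i y => (/ INR (S i) - / INR (S (S M))) * sin (INR (S i) * y))).
intros k _.
assert (INR (S k) <> 0) by (apply not_0_INR; lia).
assert (INR (S (S M)) <> 0) by (apply not_0_INR; lia).
remember (INR (S k)) as a; remember (INR (S (S M))) as b.
auto_derive; [trivial|field; auto].
Qed.

Lemma fejer_sawtooth_continuous (M : nat) (t : R) : continuous (fejer_sawtooth M) t.
Proof.
apply (ex_derive_continuous (fejer_sawtooth M)); eexists; apply is_derive_fejer_sawtooth.
Qed.

Lemma fejer_sawtooth_incr (M : nat) (x y : R) :
  x <= y -> fejer_sawtooth M x + x / 2 <= fejer_sawtooth M y + y / 2.
Proof.
intros Hxy.
set (d t := sum_f_R0 (fun i => (1 - INR (S i) / INR (S (S M))) * cos (INR (S i) * t)) M + / 2).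
assert (Hd : forall t, is_derive (fun t => fejer_sawtooth M t + t / 2) t (d t)).
{ intros t; apply (is_derive_plus (K := R_AbsRing) (V := R_NormedModule)
    (fejer_sawtooth M) (fun t => t / 2)).
  - apply is_derive_fejer_sawtooth.
  - auto_derive; [trivial|field]. }
assert (Hd0 : forall t, 0 <= d t).
{ intros t.
  assert (Hb : 0 < INR (S (S M))) by (apply lt_0_INR; lia).
  assert (Hq := fejer_square M t).
  (* Scaled by 2 (M + 2), the derivative becomes the left side of [fejer_square], hence a sum of two
     squares. *)
  assert (E : INR (S (S M)) * (2 * d t) = INR (S (S M))
    + 2 * sum_f_R0 (fun i => (INR (S (S M)) - INR (S i)) * cos (INR (S i) * t)) M).
  { unfold d; rewrite Rmult_plus_distr_l, Rmult_plus_distr_l.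
    rewrite (sum_eq (fun i => (INR (S (S M)) - INR (S i)) * cos (INR (S i) * t))
      (fun i => (1 - INR (S i) / INR (S (S M))) * cos (INR (S i) * t) * INR (S (S M)))).
    - rewrite <- scal_sum; lra.
    - intros; field; lra. }
  rewrite Hq in E.
  set (C := sum_f_R0 (fun k => cos (INR k * t)) (S M)) in *.
  set (S0 := sum_f_R0 (fun k => sin (INR k * t)) (S M)) in *.
  generalize (Rle_0_sqr C) (Rle_0_sqr S0); nra. }
destruct (MVT_gen (fun t => fejer_sawtooth M t + t / 2) x y d) as [c [_ Hc]].
- intros; apply Hd.
- intros; apply derivable_continuous_pt; exists (d x0); apply is_derive_Reals, Hd.
- generalize (Hd0 c); nra.
Qed.

Lemma periodic_Z (h : R -> R) :
  (forall t, h (t + 2 * PI) = h t) ->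
  forall (k : Z) t, h (t + IZR k * (2 * PI)) = h t.
Proof.
intros H.
assert (Hn : forall (n : nat) t, h (t + INR n * (2 * PI)) = h t).
{ induction n as [|n IH]; intros t.
  - f_equal; simpl; ring.
  - rewrite <- (IH t), <- (H (t + INR n * (2 * PI))), S_INR; f_equal; ring. }
intros k t.
destruct (Z_le_dec 0 k).
- rewrite <- (Z2Nat.id k), <- INR_IZR_INZ by lia; apply Hn.
- rewrite <- (Hn (Z.to_nat (- k)) (t + IZR k * (2 * PI))).
  rewrite INR_IZR_INZ, Z2Nat.id, opp_IZR by lia; f_equal; ring.
Qed.

Lemma sin_periodic_Z (m : Z) (t : R) : sin (IZR m * (t + 2 * PI)) = sin (IZR m * t).
Proof.
replace (IZR m * (t + 2 * PI)) with (IZR m * t + IZR m * (2 * PI)) by ring.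
apply (periodic_Z sin); intros s; rewrite <- (sin_period s 1); f_equal; simpl; ring.
Qed.

Lemma cos_2PI_Z (m : Z) : cos (IZR m * (2 * PI)) = 1.
Proof.
rewrite <- cos_0, <- (Rplus_0_l (IZR m * (2 * PI))).
apply (periodic_Z cos); intros s; rewrite <- (cos_period s 1); f_equal; simpl; ring.
Qed.

Lemma sin_2PI_Z (m : Z) : sin (IZR m * (2 * PI)) = 0.
Proof.
rewrite <- (Rplus_0_l (2 * PI)), sin_periodic_Z, Rmult_0_r; apply sin_0.
Qed.

Lemma fejer_sawtooth_periodic (M : nat) (t : R) :
  fejer_sawtooth M (t + 2 * PI) = fejer_sawtooth M t.
Proof.
apply sum_eq; intros i _; now rewrite !INR_IZR_INZ, sin_periodic_Z.
Qed.

Lemma fejer_sawtooth_0 (M : nat) : fejer_sawtooth M 0 = 0.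
Proof.
unfold fejer_sawtooth.
rewrite (sum_eq _ (fun i => 0 * 0)).
- rewrite <- scal_sum; ring.
- intros; rewrite Rmult_0_r, sin_0; ring.
Qed.

(** The function vanishes at 0 and at 2 pi, so monotonicity after adding s/2 confines its value at s
    in [0, 2 pi] between -s/2 and pi - s/2. Periodicity covers the other points. *)
Lemma fejer_sawtooth_bound (M : nat) (t : R) : Rabs (fejer_sawtooth M t) <= PI.
Proof.
assert (HPI := PI_RGT_0).
assert (H : forall s, 0 <= s <= 2 * PI -> Rabs (fejer_sawtooth M s) <= PI).
{ intros s [Hs1 Hs2].
  assert (H1 := fejer_sawtooth_incr M 0 s Hs1).
  assert (H2 := fejer_sawtooth_incr M s (2 * PI) Hs2).
  rewrite <- (Rplus_0_l (2 * PI)), fejer_sawtooth_periodic, fejer_sawtooth_0 in H2.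
  rewrite fejer_sawtooth_0 in H1.
  apply Rabs_le; lra. }
set (k := Int_part (t / (2 * PI))).
destruct (base_Int_part (t / (2 * PI))) as [Hk1 Hk2]; fold k in Hk1, Hk2.
rewrite <- (periodic_Z _ (fejer_sawtooth_periodic M) (- k) t), opp_IZR.
assert (E : t = t / (2 * PI) * (2 * PI)) by (field; lra).
apply H; rewrite E at 1 2; split; nra.
Qed.

(** Each increment ln(n + 1) - ln n = ln(1 + 1/n) is at most 1/n, and these increments telescope
    from ln 1 = 0. *)
Lemma ln_le_harmonic (M : nat) : ln (INR (S (S M))) <= sum_f_R0 (fun i => / INR (S i)) M.
Proof.
assert (Hstep : forall n : nat, ln (INR (S (S n))) <= ln (INR (S n)) + / INR (S n)).
{ intros n.
  assert (Hn : 0 < INR (S n)) by (apply lt_0_INR; lia).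
  rewrite (S_INR (S n)).
  replace (INR (S n) + 1) with (INR (S n) * (1 + / INR (S n))) by (field; lra).
  assert (Hi := Rinv_0_lt_compat _ Hn).
  rewrite ln_mult by lra.
  apply Rplus_le_compat_l.
  rewrite <- (ln_exp (/ INR (S n))) at 2.
  apply ln_le; [lra|]; left; apply exp_ineq1; lra. }
induction M as [|M IH].
- generalize (Hstep 0%nat); simpl sum_f_R0; simpl (INR 1); rewrite ln_1; lra.
- rewrite tech5; generalize (Hstep (S M)); lra.
Qed.

(** The correction 1/(M + 2) is subtracted M + 1 times, which costs the harmonic sum less than 1. *)
Lemma fejer_sawtooth_coef_sum (M : nat) :
  ln (INR (S (S M))) - 1 <= sum_f_R0 (fun i => / INR (S i) - / INR (S (S M))) M.
Proof.
rewrite minus_sum.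
assert (H := ln_le_harmonic M).
rewrite sum_cte.
assert (0 < INR (S (S M))) by (apply lt_0_INR; lia).
assert (/ INR (S (S M)) * INR (S M) <= 1).
{ rewrite (S_INR (S M)) in *; apply Rmult_le_reg_l with (INR (S M) + 1); [lra|].
  field_simplify; lra. }
lra.
Qed.

Lemma fejer_sawtooth_coef_pos (M i : nat) :
  (i <= M)%nat -> 0 <= / INR (S i) - / INR (S (S M)).
Proof.
intros Hi.
assert (/ INR (S (S M)) <= / INR (S i)); [|lra].
apply Rinv_le_contravar; [apply lt_0_INR; lia|apply le_INR; lia].
Qed.

(** * Fourier coefficients and partial sums at 0 *)

Lemma continuous_Rmult (f g : R -> R) (t : R) :
  continuous f t -> continuous g t -> continuous (fun x => f x * g x) t.
Proof. intros Hf Hg; exact (continuous_mult (K := R_AbsRing) f g t Hf Hg). Qed.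

Lemma continuous_Rplus (f g : R -> R) (t : R) :
  continuous f t -> continuous g t -> continuous (fun x => f x + g x) t.
Proof. intros Hf Hg; exact (continuous_plus (V := R_NormedModule) f g t Hf Hg). Qed.

Lemma continuous_sum_f_R0 (u : nat -> R -> R) (J : nat) (t : R) :
  (forall i, continuous (u i) t) -> continuous (fun x => sum_f_R0 (fun i => u i x) J) t.
Proof.
intros H; induction J as [|J IH]; simpl; [apply H|apply continuous_Rplus; auto].
Qed.

Lemma continuous_sin_scal (a t : R) : continuous (fun x => sin (a * x)) t.
Proof. apply (ex_derive_continuous (fun x => sin (a * x))); auto_derive; trivial. Qed.

Lemma continuous_cos_scal (a t : R) : continuous (fun x => cos (a * x)) t.
Proof. apply (ex_derive_continuous (fun x => cos (a * x))); auto_derive; trivial. Qed.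

(** * Integration over one period and orthogonality *)

Definition integral_T (h : R -> R) : R := RInt h 0 (2 * PI).

Lemma ex_RInt_T (h : R -> R) : (forall t, continuous h t) -> ex_RInt h 0 (2 * PI).
Proof. intros H; apply (ex_RInt_continuous (V := R_CompleteNormedModule)); auto. Qed.

Lemma integral_T_plus (u v : R -> R) :
  (forall t, continuous u t) -> (forall t, continuous v t) ->
  integral_T (fun t => u t + v t) = integral_T u + integral_T v.
Proof.
intros Hu Hv;
exact (RInt_plus (V := R_CompleteNormedModule) u v 0 (2 * PI) (ex_RInt_T u Hu) (ex_RInt_T v Hv)).
Qed.

Lemma integral_T_scal (c : R) (u : R -> R) :
  (forall t, continuous u t) -> integral_T (fun t => c * u t) = c * integral_T u.
Proof.
intros Hu;
exact (RInt_scal (V := R_CompleteNormedModule) u 0 (2 * PI) c (ex_RInt_T u Hu)).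
Qed.

Lemma integral_T_ext (u v : R -> R) :
  (forall t, u t = v t) -> integral_T u = integral_T v.
Proof. intros H; apply (RInt_ext (V := R_CompleteNormedModule)); auto. Qed.

Lemma integral_T_close (u v : R -> R) (e : R) :
  (forall t, continuous u t) -> (forall t, continuous v t) ->
  (forall t, Rabs (u t - v t) <= e) ->
  Rabs (integral_T u - integral_T v) <= 2 * PI * e.
Proof.
intros Hu Hv H.
assert (HPI := PI_RGT_0).
assert (E : integral_T u - integral_T v = integral_T (fun t => u t + -1 * v t)).
{ rewrite integral_T_plus, integral_T_scal; auto; [ring|].
  intros; apply (continuous_Rmult (fun _ => -1)); auto; apply continuous_const. }
rewrite E; replace (2 * PI * e) with ((2 * PI - 0) * e) by ring.
apply abs_RInt_le_const; [lra| |].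
- apply ex_RInt_T; intros t; apply continuous_Rplus; auto.
  apply (continuous_Rmult (fun _ => -1)); auto; apply continuous_const.
- intros t _; replace (u t + -1 * v t) with (u t - v t) by ring; apply H.
Qed.

Lemma integral_T_derive (F f : R -> R) :
  (forall t, is_derive F t (f t)) -> (forall t, continuous f t) ->
  integral_T f = F (2 * PI) - F 0.
Proof.
intros HF Hf; apply (is_RInt_unique (V := R_CompleteNormedModule)).
apply (is_RInt_derive (V := R_CompleteNormedModule) F f); auto.
Qed.

Definition kronecker (k m : Z) : R := if Z.eq_dec k m then 1 else 0.

Lemma kronecker_sub_0 (m k : Z) : kronecker (m - k) 0 = kronecker k m.
Proof. unfold kronecker; repeat destruct Z.eq_dec; lia || reflexivity. Qed.

Lemma kronecker_add_0 (m k : Z) : kronecker (m + k) 0 = kronecker k (- m).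
Proof. unfold kronecker; repeat destruct Z.eq_dec; lia || reflexivity. Qed.

Lemma integral_T_cos (m : Z) : integral_T (fun t => cos (IZR m * t)) = 2 * PI * kronecker m 0.
Proof.
unfold kronecker; destruct (Z.eq_dec m 0) as [->|Hm].
- rewrite (integral_T_derive (fun t => t)).
  + ring.
  + intros t; rewrite Rmult_0_l, cos_0; apply (is_derive_id (K := R_AbsRing)).
  + intros; apply continuous_cos_scal.
- assert (IZR m <> 0) by now apply not_0_IZR.
  rewrite (integral_T_derive (fun t => / IZR m * sin (IZR m * t))).
  + rewrite sin_2PI_Z, (Rmult_0_r (IZR m)), sin_0; ring.
  + intros t; auto_derive; [trivial|field; auto].
  + intros; apply continuous_cos_scal.
Qed.

Lemma integral_T_sin (m : Z) : integral_T (fun t => sin (IZR m * t)) = 0.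
Proof.
destruct (Z.eq_dec m 0) as [->|Hm].
- rewrite (integral_T_derive (fun t => 0)).
  + ring.
  + intros t; rewrite Rmult_0_l, sin_0.
    apply (is_derive_const (K := R_AbsRing) (V := R_NormedModule)).
  + intros; apply continuous_sin_scal.
- assert (IZR m <> 0) by now apply not_0_IZR.
  rewrite (integral_T_derive (fun t => - / IZR m * cos (IZR m * t))).
  + rewrite cos_2PI_Z, (Rmult_0_r (IZR m)), cos_0; ring.
  + intros t; auto_derive; [trivial|field; auto].
  + intros; apply continuous_sin_scal.
Qed.

(** The factor is 1/(2 pi), not the classical 1/pi, so that [fourier_coef] of a real function has
    real part [cos_coef] and imaginary part [- sin_coef]. *)
Definition cos_coef (h : R -> R) (k : Z) : R :=
  / (2 * PI) * integral_T (fun t => h t * cos (IZR k * t)).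

Definition sin_coef (h : R -> R) (k : Z) : R :=
  / (2 * PI) * integral_T (fun t => h t * sin (IZR k * t)).

(** Product-to-sum formula and orthogonality. At [m = 0] the two Kronecker terms coincide, which
    gives the constant function its coefficient 1. *)
Lemma cos_coef_cos (m k : Z) :
  cos_coef (fun t => cos (IZR m * t)) k = / 2 * (kronecker k m + kronecker k (- m)).
Proof.
assert (HPI := PI_RGT_0).
unfold cos_coef.
rewrite (integral_T_ext _ (fun t => / 2 * (cos (IZR (m - k) * t) + cos (IZR (m + k) * t)))).
- rewrite integral_T_scal, integral_T_plus, !integral_T_cos;
    try (intros; try apply continuous_Rplus; apply continuous_cos_scal).
  rewrite kronecker_sub_0, kronecker_add_0.
  field; lra.
- intros t; rewrite minus_IZR, plus_IZR, Rmult_minus_distr_r, Rmult_plus_distr_r.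
  rewrite cos_minus, cos_plus; field.
Qed.

Lemma sin_coef_sin (n k : Z) :
  sin_coef (fun t => sin (IZR n * t)) k = / 2 * (kronecker k n - kronecker k (- n)).
Proof.
assert (HPI := PI_RGT_0).
unfold sin_coef.
rewrite (integral_T_ext _ (fun t => / 2 * (cos (IZR (n - k) * t) + -1 * cos (IZR (n + k) * t)))).
- assert (H : forall t, continuous (fun t => -1 * cos (IZR (n + k) * t)) t).
  { intros t; apply (continuous_Rmult (fun _ => -1));
      [apply continuous_const|apply continuous_cos_scal]. }
  rewrite integral_T_scal, integral_T_plus, integral_T_scal, !integral_T_cos;
    try (intros; try apply continuous_Rplus; auto; apply continuous_cos_scal).
  rewrite kronecker_sub_0, kronecker_add_0.
  field; lra.
- intros t; rewrite minus_IZR, plus_IZR, Rmult_minus_distr_r, Rmult_plus_distr_r.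
  rewrite cos_minus, cos_plus; field.
Qed.

Lemma cos_coef_sin (n k : Z) : cos_coef (fun t => sin (IZR n * t)) k = 0.
Proof.
assert (HPI := PI_RGT_0).
unfold cos_coef.
rewrite (integral_T_ext _ (fun t => / 2 * (sin (IZR (n - k) * t) + sin (IZR (n + k) * t)))).
- rewrite integral_T_scal, integral_T_plus, !integral_T_sin;
    try (intros; try apply continuous_Rplus; apply continuous_sin_scal).
  ring.
- intros t; rewrite minus_IZR, plus_IZR, Rmult_minus_distr_r, Rmult_plus_distr_r.
  rewrite sin_minus, sin_plus; field.
Qed.

Lemma integral_T_mult_plus_l (u v phi : R -> R) :
  (forall t, continuous u t) -> (forall t, continuous v t) -> (forall t, continuous phi t) ->
  integral_T (fun t => (u t + v t) * phi t)
  = integral_T (fun t => u t * phi t) + integral_T (fun t => v t * phi t).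
Proof.
intros Hu Hv Hp; rewrite <- integral_T_plus.
- apply integral_T_ext; intros; ring.
- intros; now apply continuous_Rmult.
- intros; now apply continuous_Rmult.
Qed.

Lemma cos_coef_plus (u v : R -> R) (k : Z) :
  (forall t, continuous u t) -> (forall t, continuous v t) ->
  cos_coef (fun t => u t + v t) k = cos_coef u k + cos_coef v k.
Proof.
intros; unfold cos_coef; rewrite integral_T_mult_plus_l; auto;
  [ring|intros; apply continuous_cos_scal].
Qed.

Lemma sin_coef_plus (u v : R -> R) (k : Z) :
  (forall t, continuous u t) -> (forall t, continuous v t) ->
  sin_coef (fun t => u t + v t) k = sin_coef u k + sin_coef v k.
Proof.
intros; unfold sin_coef; rewrite integral_T_mult_plus_l; auto;
  [ring|intros; apply continuous_sin_scal].
Qed.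

Lemma cos_coef_scal (c : R) (u : R -> R) (k : Z) :
  (forall t, continuous u t) -> cos_coef (fun t => c * u t) k = c * cos_coef u k.
Proof.
intros; unfold cos_coef.
rewrite (integral_T_ext _ (fun t => c * (u t * cos (IZR k * t)))) by (intros; ring).
rewrite integral_T_scal; [ring|intros; apply continuous_Rmult; auto; apply continuous_cos_scal].
Qed.

Lemma sin_coef_scal (c : R) (u : R -> R) (k : Z) :
  (forall t, continuous u t) -> sin_coef (fun t => c * u t) k = c * sin_coef u k.
Proof.
intros; unfold sin_coef.
rewrite (integral_T_ext _ (fun t => c * (u t * sin (IZR k * t)))) by (intros; ring).
rewrite integral_T_scal; [ring|intros; apply continuous_Rmult; auto; apply continuous_sin_scal].
Qed.

Lemma mean_mult_close (u v phi : R -> R) (e : R) :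
  (forall t, continuous u t) -> (forall t, continuous v t) -> (forall t, continuous phi t) ->
  (forall t, Rabs (phi t) <= 1) -> (forall t, Rabs (u t - v t) <= e) ->
  Rabs (/ (2 * PI) * integral_T (fun t => u t * phi t)
        - / (2 * PI) * integral_T (fun t => v t * phi t)) <= e.
Proof.
intros Hu Hv Hp Hb He.
assert (HPI := PI_RGT_0).
rewrite <- Rmult_minus_distr_l, Rabs_mult.
assert (Hi : 0 < / (2 * PI)) by (apply Rinv_0_lt_compat; lra).
rewrite (Rabs_right (/ (2 * PI))) by lra.
apply Rmult_le_reg_l with (2 * PI); [lra|].
rewrite <- Rmult_assoc, Rinv_r, Rmult_1_l by lra.
apply integral_T_close; try (intros; now apply continuous_Rmult).
intros t; rewrite <- Rmult_minus_distr_r, Rabs_mult.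
generalize (Rabs_pos (u t - v t)) (Rabs_pos (phi t)) (He t) (Hb t); nra.
Qed.

Lemma cos_coef_close (u v : R -> R) (k : Z) (e : R) :
  (forall t, continuous u t) -> (forall t, continuous v t) ->
  (forall t, Rabs (u t - v t) <= e) -> Rabs (cos_coef u k - cos_coef v k) <= e.
Proof.
intros; apply mean_mult_close; auto; intros.
- apply continuous_cos_scal.
- apply Rabs_le, COS_bound.
Qed.

Lemma sin_coef_close (u v : R -> R) (k : Z) (e : R) :
  (forall t, continuous u t) -> (forall t, continuous v t) ->
  (forall t, Rabs (u t - v t) <= e) -> Rabs (sin_coef u k - sin_coef v k) <= e.
Proof.
intros; apply mean_mult_close; auto; intros.
- apply continuous_sin_scal.
- apply Rabs_le, SIN_bound.
Qed.

(** The complex integral is taken componentwise; the minus sign is that of e^{-ikt}. From here on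
    the argument stays within real integrals. *)
Lemma fourier_coef_RtoC (h : R -> R) (k : Z) :
  (forall t, continuous h t) ->
  fourier_coef (fun t => RtoC (h t)) k = (cos_coef h k, - sin_coef h k).
Proof.
intros Hh; unfold fourier_coef.
rewrite (is_RInt_unique (V := C_R_CompleteNormedModule) _ 0 (2 * PI)
  (integral_T (fun t => h t * cos (IZR k * t)), - integral_T (fun t => h t * sin (IZR k * t)))).
- unfold cos_coef, sin_coef, Cmult; simpl; f_equal; ring.
- apply (is_RInt_fct_extend_pair (U := R_NormedModule) (V := R_NormedModule)).
  + apply (is_RInt_ext (V := R_NormedModule) (fun t => h t * cos (IZR k * t))).
    * intros t _; simpl.
      replace (- IZR k * t) with (- (IZR k * t)) by ring.
      rewrite cos_neg; ring.
    * apply (RInt_correct (V := R_CompleteNormedModule)), ex_RInt_T.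
      intros; apply continuous_Rmult; auto; apply continuous_cos_scal.
  + apply (is_RInt_ext (V := R_NormedModule) (fun t => opp (h t * sin (IZR k * t)))).
    * intros t _; unfold opp; simpl.
      replace (- IZR k * t) with (- (IZR k * t)) by ring.
      rewrite sin_neg; ring.
    * apply (is_RInt_opp (V := R_NormedModule)).
      apply (RInt_correct (V := R_CompleteNormedModule)), ex_RInt_T.
      intros; apply continuous_Rmult; auto; apply continuous_sin_scal.
Qed.

(** Real part of the Fourier partial sum at the point 0, where all exponentials equal 1: see
    [Re_fourier_sum_0]. *)
Definition partial_sum_0 (h : R -> R) (N : nat) : R := sum_sym (cos_coef h) N.

Lemma fst_sum_n (u : nat -> C) (n : nat) :
  fst (sum_n (G := C_AbelianMonoid) u n) = sum_n (fun j => fst (u j)) n.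
Proof.
induction n as [|n IH].
- now rewrite !sum_O.
- now rewrite !sum_Sn, <- IH.
Qed.

Lemma Re_fourier_sum_0 (h : R -> R) (N : nat) :
  (forall t, continuous h t) ->
  fst (fourier_sum (fun t => RtoC (h t)) N 0) = partial_sum_0 h N.
Proof.
intros Hh; unfold fourier_sum, partial_sum_0, sum_sym.
rewrite fst_sum_n.
apply sum_n_ext; intros n; rewrite fourier_coef_RtoC by assumption.
simpl; rewrite Rmult_0_r, cos_0, sin_0.
change (AbelianMonoid.sort R_AbelianMonoid) with R; ring.
Qed.

Lemma partial_sum_0_plus (u v : R -> R) (N : nat) :
  (forall t, continuous u t) -> (forall t, continuous v t) ->
  partial_sum_0 (fun t => u t + v t) N = partial_sum_0 u N + partial_sum_0 v N.
Proof.
intros Hu Hv; unfold partial_sum_0; rewrite <- sum_sym_plus.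
apply sum_sym_ext; intros; now apply cos_coef_plus.
Qed.

Lemma partial_sum_0_scal (c : R) (u : R -> R) (N : nat) :
  (forall t, continuous u t) ->
  partial_sum_0 (fun t => c * u t) N = c * partial_sum_0 u N.
Proof.
intros Hu; unfold partial_sum_0; rewrite <- sum_sym_scal.
apply sum_sym_ext; intros; now apply cos_coef_scal.
Qed.

Lemma partial_sum_0_sum (u : nat -> R -> R) (J N : nat) :
  (forall i t, continuous (u i) t) ->
  partial_sum_0 (fun t => sum_f_R0 (fun i => u i t) J) N
  = sum_f_R0 (fun i => partial_sum_0 (u i) N) J.
Proof.
intros Hu; induction J as [|J IH]; [reflexivity|].
rewrite tech5, <- IH.
apply (partial_sum_0_plus (fun t => sum_f_R0 (fun i => u i t) J)); auto.
intros; now apply continuous_sum_f_R0.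
Qed.

Lemma partial_sum_0_ext (u v : R -> R) (N : nat) :
  (forall t, u t = v t) -> partial_sum_0 u N = partial_sum_0 v N.
Proof.
intros H; apply sum_sym_ext; intros k; unfold cos_coef; f_equal.
apply integral_T_ext; intros; now rewrite H.
Qed.

(** The factor [sum_sym (fun _ => 1) N], which is 2N + 1, counts the coefficients. This crude bound
    suffices because [N] stays fixed while [e] tends to 0. *)
Lemma partial_sum_0_close (u v : R -> R) (N : nat) (e : R) :
  (forall t, continuous u t) -> (forall t, continuous v t) ->
  (forall t, Rabs (u t - v t) <= e) ->
  partial_sum_0 u N <= partial_sum_0 v N + sum_sym (fun _ => 1) N * e.
Proof.
intros Hu Hv He; unfold partial_sum_0.
rewrite Rmult_comm, <- sum_sym_scal, <- sum_sym_plus.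
apply sum_sym_le; intros k.
generalize (cos_coef_close u v k e Hu Hv He) (Rle_abs (cos_coef u k - cos_coef v k)); lra.
Qed.

(** Serves twice: [phi] constant 1 gives the partial sums of a cosine, and [phi = gamma] gives the
    weighted coefficient sum of a single sine. *)
Lemma sum_sym_kron (phi : nat -> R) (m : Z) (N : nat) :
  (sum_sym (fun k => / 2 * (kronecker k m + kronecker k (- m)) * phi (Z.abs_nat k)) N : R)
  = if Z_le_dec (Z.abs m) (Z.of_nat N) then phi (Z.abs_nat m) else 0.
Proof.
induction N as [|N IH].
- rewrite sum_sym_O; unfold kronecker; destruct Z_le_dec.
  + replace m with 0%Z by lia; simpl; lra.
  + repeat destruct Z.eq_dec; lia || lra.
- rewrite sum_sym_S, IH; unfold kronecker.
  replace (Z.abs_nat (- Z.of_nat (S N))) with (S N) by lia.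
  replace (Z.abs_nat (Z.of_nat (S N))) with (S N) by lia.
  repeat destruct Z_le_dec; repeat destruct Z.eq_dec; try lia; try lra;
    replace (Z.abs_nat m) with (S N) by lia; lra.
Qed.

Lemma partial_sum_0_cos (m : Z) (N : nat) :
  partial_sum_0 (fun t => cos (IZR m * t)) N
  = if Z_le_dec (Z.abs m) (Z.of_nat N) then 1 else 0.
Proof.
rewrite <- (sum_sym_kron (fun _ => 1)).
apply sum_sym_ext; intros k; rewrite cos_coef_cos; ring.
Qed.

Lemma partial_sum_0_sin_sin (n p : Z) (N : nat) :
  partial_sum_0 (fun t => sin (IZR n * t) * sin (IZR p * t)) N
  = / 2 * ((if Z_le_dec (Z.abs (n - p)) (Z.of_nat N) then 1 else 0)
           - (if Z_le_dec (Z.abs (n + p)) (Z.of_nat N) then 1 else 0)).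
Proof.
rewrite <- !partial_sum_0_cos.
rewrite (partial_sum_0_ext _ (fun t => / 2 * (cos (IZR (n - p) * t) + -1 * cos (IZR (n + p) * t)))).
- assert (H : forall t, continuous (fun t => -1 * cos (IZR (n + p) * t)) t).
  { intros t; apply (continuous_Rmult (fun _ => -1));
      [apply continuous_const|apply continuous_cos_scal]. }
  rewrite partial_sum_0_scal, partial_sum_0_plus, partial_sum_0_scal;
    try (intros; try apply continuous_Rplus; auto; apply continuous_cos_scal).
  ring.
- intros t; rewrite minus_IZR, plus_IZR, Rmult_minus_distr_r, Rmult_plus_distr_r.
  rewrite cos_minus, cos_plus; field.
Qed.

(** * The two series *)

Lemma Cmod_le_Rabs (x y : R) : Cmod (x, y) <= Rabs x + Rabs y.
Proof.
replace (x, y) with (RtoC x + RtoC y * Ci)%C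
  by (unfold Cplus, Cmult, RtoC, Ci; simpl; f_equal; ring).
eapply Rle_trans; [apply Cmod_triangle|].
rewrite Cmod_mult, !Cmod_R, Cmod_Ci; lra.
Qed.

Lemma in_CT_RtoC (h : R -> R) :
  (forall t, continuous h t) -> (forall t, h (t + 2 * PI) = h t) ->
  in_CT (fun t => RtoC (h t)).
Proof.
intros Hc Hp; split.
- intros t; now rewrite Hp.
- intros t; apply filterlim_locally; intros eps.
  assert (H := proj1 (filterlim_locally h (h t)) (Hc t)).
  generalize (H eps); apply filter_imp; intros x Hx.
  split; [exact Hx|apply (ball_center (M := R_UniformSpace))].
Qed.

(** The sup norm dominates the error at the single point 0, where [h] vanishes, and the modulus
    dominates the real part. *)
Lemma in_UT_partial_sum_0 (h : R -> R) (eps : R) :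
  (forall t, continuous h t) -> h 0 = 0 -> 0 < eps ->
  in_UT (fun t => RtoC (h t)) ->
  exists N0 : nat, forall N, (N0 <= N)%nat -> partial_sum_0 h N < eps.
Proof.
intros Hc H0 He [_ HU].
destruct (HU eps He) as [N0 HN]; exists N0; intros N HN0; specialize (HN N HN0).
unfold sup_norm in HN.
match type of HN with Rbar_lt (Lub_Rbar ?E) _ =>
  destruct (Lub_Rbar_correct E) as [Hub _] end.
specialize (Hub _ (ex_intro _ 0 eq_refl)).
assert (Hlt := Rbar_le_lt_trans _ _ _ Hub HN); simpl in Hlt.
eapply Rle_lt_trans; [|exact Hlt].
eapply Rle_trans; [|apply re_le_Cmod].
unfold Re; cbn [fst Cminus Cplus Copp RtoC].
rewrite H0, Re_fourier_sum_0 by assumption.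
rewrite Rplus_0_l, Rabs_Ropp; apply Rle_abs.
Qed.

Definition sine_series (a : nat -> R) (n : nat -> nat) (t : R) : R :=
  Series (fun j => a j * sin (IZR (Z.of_nat (n j)) * t)).

Definition sine_sum (a : nat -> R) (n : nat -> nat) (J : nat) (t : R) : R :=
  sum_f_R0 (fun j => a j * sin (IZR (Z.of_nat (n j)) * t)) J.

Lemma sine_series_close (a : nat -> R) (n : nat -> nat) (J : nat) (t : R) :
  (forall j, 0 <= a j <= (/ 2) ^ j) ->
  Rabs (sine_series a n t - sine_sum a n J t) <= 1 * (/ 2) ^ J.
Proof.
intros Ha; apply Series_half_pow_tail; intros j.
destruct (Ha j); rewrite Rabs_mult, Rabs_right by lra.
assert (Hs : Rabs (sin (IZR (Z.of_nat (n j)) * t)) <= 1) by apply Rabs_le, SIN_bound.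
generalize (Rabs_pos (sin (IZR (Z.of_nat (n j)) * t))); nra.
Qed.

Lemma sine_term_continuous (a : nat -> R) (n : nat -> nat) (j : nat) (t : R) :
  continuous (fun t => a j * sin (IZR (Z.of_nat (n j)) * t)) t.
Proof.
apply (continuous_Rmult (fun _ => a j)); [apply continuous_const|apply continuous_sin_scal].
Qed.

Lemma sine_sum_continuous (a : nat -> R) (n : nat -> nat) (J : nat) (t : R) :
  continuous (sine_sum a n J) t.
Proof. apply continuous_sum_f_R0; intros; apply sine_term_continuous. Qed.

Lemma sine_series_continuous (a : nat -> R) (n : nat -> nat) :
  (forall j, 0 <= a j <= (/ 2) ^ j) -> forall t, continuous (sine_series a n) t.
Proof.
intros Ha; apply (continuous_half_pow_limit (sine_sum a n) _ 1).
- intros; apply sine_sum_continuous.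
- intros; now apply sine_series_close.
Qed.

Lemma cos_coef_sine_sum (a : nat -> R) (n : nat -> nat) (J : nat) (k : Z) :
  cos_coef (sine_sum a n J) k = 0.
Proof.
assert (H : forall j, cos_coef (fun t => a j * sin (IZR (Z.of_nat (n j)) * t)) k = 0).
{ intros j; rewrite cos_coef_scal by (intros; apply continuous_sin_scal).
  rewrite cos_coef_sin; ring. }
induction J as [|J IH]; [apply H|].
unfold sine_sum; simpl sum_f_R0.
rewrite (cos_coef_plus (sine_sum a n J)), IH, H; [ring| |].
- intros; apply sine_sum_continuous.
- intros; apply sine_term_continuous.
Qed.

(** Frequencies may coincide, hence the triangle inequality. The difference of Kronecker terms from
    [sin_coef_sin] is enlarged to a sum, the form that [sum_sym_kron] evaluates. *)
Lemma sin_coef_sine_sum (a : nat -> R) (n : nat -> nat) (J : nat) (k : Z) :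
  (forall j, 0 <= a j) ->
  Rabs (sin_coef (sine_sum a n J) k)
  <= sum_f_R0 (fun j =>
       a j * (/ 2 * (kronecker k (Z.of_nat (n j)) + kronecker k (- Z.of_nat (n j))))) J.
Proof.
intros Ha.
assert (H : forall j, Rabs (sin_coef (fun t => a j * sin (IZR (Z.of_nat (n j)) * t)) k)
  <= a j * (/ 2 * (kronecker k (Z.of_nat (n j)) + kronecker k (- Z.of_nat (n j))))).
{ intros j; rewrite sin_coef_scal by (intros; apply continuous_sin_scal).
  rewrite sin_coef_sin, Rabs_mult, Rabs_right by (apply Rle_ge, Ha).
  apply Rmult_le_compat_l; [apply Ha|].
  unfold kronecker; repeat destruct Z.eq_dec; apply Rabs_le; lra. }
induction J as [|J IH]; [apply H|].
unfold sine_sum; simpl sum_f_R0.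
rewrite (sin_coef_plus (sine_sum a n J)).
- eapply Rle_trans; [apply Rabs_triang|]; apply Rplus_le_compat; [apply IH|apply H].
- intros; apply sine_sum_continuous.
- intros; apply sine_term_continuous.
Qed.

Lemma sine_series_periodic (a : nat -> R) (n : nat -> nat) (t : R) :
  sine_series a n (t + 2 * PI) = sine_series a n t.
Proof. apply Series_ext; intros j; now rewrite sin_periodic_Z. Qed.

(** The weighted sums increase with [N], so a bound is enough. Each sine contributes at most
    [a j * gamma (n j)], and the majorants [(/ 2) ^ j] sum to 2. *)
Lemma sine_series_in_AT (gamma : nat -> R) (a : nat -> R) (n : nat -> nat) :
  (forall k, 0 < gamma k) ->
  (forall j, 0 <= a j <= (/ 2) ^ j) ->
  (forall j, a j * gamma (n j) <= (/ 2) ^ j) ->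
  in_AT gamma (fun t => RtoC (sine_series a n t)).
Proof.
intros Hg Ha Hag.
assert (Hc := sine_series_continuous a n Ha).
split; [apply in_CT_RtoC; [exact Hc|intros; apply sine_series_periodic]|].
apply ex_finite_lim_seq_incr with 2; intros N.
- rewrite sum_sym_S.
  assert (H : forall k, 0 <= Cmod (fourier_coef (fun t => RtoC (sine_series a n t)) k)
    * gamma (Z.abs_nat k)).
  { intros k; apply Rmult_le_pos; [apply Cmod_ge_0|left; apply Hg]. }
  generalize (H (Z.of_nat (S N))) (H (- Z.of_nat (S N))%Z); lra.
(* With [N] fixed, the series is truncated at [J]. The cosine and the sine coefficient each err by
   at most [(/ 2) ^ J], whence the factor 2. *)
- apply (le_of_half_pow _ _ (2 * sum_sym (fun k => gamma (Z.abs_nat k)) N) 0).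
  intros J _.
  apply Rle_trans with
    (sum_sym (fun k =>
       sum_f_R0 (fun j =>
         a j * (/ 2 * (kronecker k (Z.of_nat (n j)) + kronecker k (- Z.of_nat (n j)))
         * gamma (Z.abs_nat k))) J
       + 2 * (/ 2) ^ J * gamma (Z.abs_nat k)) N).
  + apply sum_sym_le; intros k.
    rewrite (sum_eq _ (fun j =>
      a j * (/ 2 * (kronecker k (Z.of_nat (n j)) + kronecker k (- Z.of_nat (n j))))
      * gamma (Z.abs_nat k))) by (intros; ring).
    rewrite <- scal_sum, (Rmult_comm (gamma _)), <- Rmult_plus_distr_r.
    apply Rmult_le_compat_r; [left; apply Hg|].
    rewrite fourier_coef_RtoC by assumption.
    eapply Rle_trans; [apply Cmod_le_Rabs|]; rewrite Rabs_Ropp.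
    assert (Hcl : forall t, Rabs (sine_series a n t - sine_sum a n J t) <= (/ 2) ^ J).
    { intros t; rewrite <- (Rmult_1_l ((/ 2) ^ J)); now apply sine_series_close. }
    assert (Hcs := cos_coef_close _ _ k _ Hc (sine_sum_continuous a n J) Hcl).
    assert (Hsn := sin_coef_close _ _ k _ Hc (sine_sum_continuous a n J) Hcl).
    rewrite cos_coef_sine_sum, Rminus_0_r in Hcs.
    assert (Hb := sin_coef_sine_sum a n J k (fun j => proj1 (Ha j))).
    generalize (Rabs_triang_inv (sin_coef (sine_series a n) k) (sin_coef (sine_sum a n J) k)); lra.
  + rewrite sum_sym_plus, sum_sym_scal, sum_sym_sum.
    assert (H : sum_f_R0 (fun j => sum_sym (fun k => a j *
      (/ 2 * (kronecker k (Z.of_nat (n j)) + kronecker k (- Z.of_nat (n j)))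
       * gamma (Z.abs_nat k))) N) J
      <= sum_f_R0 (fun j => (/ 2) ^ j) J).
    (* The frequency [n j] either lies in the window and yields [a j * gamma (n j)], or contributes
       0. *)
    { apply sum_Rle; intros j _; rewrite sum_sym_scal, sum_sym_kron.
      rewrite Zabs2Nat.id.
      destruct Z_le_dec; [apply Hag|].
      rewrite Rmult_0_r; apply pow_le; lra. }
    rewrite sum_half_pow in H.
    assert (0 < (/ 2) ^ J) by (apply pow_lt; lra).
    lra.
Qed.

(** * The series of Fejer means and its bounded variation *)

Definition fejer_series (n : nat -> nat) (t : R) : R :=
  Series (fun l => (/ 2) ^ l * fejer_sawtooth (n l) t).

Definition fejer_sum (n : nat -> nat) (J : nat) (t : R) : R :=
  sum_f_R0 (fun l => (/ 2) ^ l * fejer_sawtooth (n l) t) J.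

Lemma half_pow_pos (j : nat) : 0 < (/ 2) ^ j.
Proof. apply pow_lt; lra. Qed.

Lemma fejer_term_bound (n : nat -> nat) (l : nat) (t : R) :
  Rabs ((/ 2) ^ l * fejer_sawtooth (n l) t) <= PI * (/ 2) ^ l.
Proof.
rewrite Rabs_mult, (Rabs_right ((/ 2) ^ l)) by (left; apply half_pow_pos).
rewrite Rmult_comm; apply Rmult_le_compat_r; [left; apply half_pow_pos|apply fejer_sawtooth_bound].
Qed.

Lemma fejer_series_close (n : nat -> nat) (J : nat) (t : R) :
  Rabs (fejer_series n t - fejer_sum n J t) <= PI * (/ 2) ^ J.
Proof. apply Series_half_pow_tail; intros; apply fejer_term_bound. Qed.

Lemma fejer_term_continuous (n : nat -> nat) (l : nat) (t : R) :
  continuous (fun t => (/ 2) ^ l * fejer_sawtooth (n l) t) t.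
Proof.
apply (continuous_Rmult (fun _ => (/ 2) ^ l));
  [apply continuous_const|apply fejer_sawtooth_continuous].
Qed.

Lemma fejer_sum_continuous (n : nat -> nat) (J : nat) (t : R) :
  continuous (fejer_sum n J) t.
Proof. apply continuous_sum_f_R0; intros; apply fejer_term_continuous. Qed.

Lemma fejer_series_continuous (n : nat -> nat) (t : R) : continuous (fejer_series n) t.
Proof.
revert t; apply (continuous_half_pow_limit (fejer_sum n) _ PI).
- intros; apply fejer_sum_continuous.
- intros; apply fejer_series_close.
Qed.

Lemma fejer_series_periodic (n : nat -> nat) (t : R) :
  fejer_series n (t + 2 * PI) = fejer_series n t.
Proof. apply Series_ext; intros j; now rewrite fejer_sawtooth_periodic. Qed.

(** Each Fejer mean becomes nondecreasing after adding t/2, and the weights [(/ 2) ^ l] sum to 2, so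
    slope 1 compensates the whole series. *)
Lemma fejer_series_incr (n : nat -> nat) (x y : R) :
  x <= y -> fejer_series n x + x <= fejer_series n y + y.
Proof.
intros Hxy.
apply (le_of_half_pow _ _ (2 * PI) 0); intros J _.
assert (H : forall J, fejer_sum n J x + sum_f_R0 (fun j => (/ 2) ^ j) J * (x / 2)
  <= fejer_sum n J y + sum_f_R0 (fun j => (/ 2) ^ j) J * (y / 2)).
{ assert (Hl : forall l, (/ 2) ^ l * fejer_sawtooth (n l) x + (/ 2) ^ l * (x / 2)
    <= (/ 2) ^ l * fejer_sawtooth (n l) y + (/ 2) ^ l * (y / 2)).
  { intros l; generalize (fejer_sawtooth_incr (n l) x y Hxy) (half_pow_pos l); nra. }
  intros K; unfold fejer_sum; induction K as [|K IH]; [apply Hl|].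
  rewrite !tech5; generalize (Hl (S K)); lra. }
specialize (H J); rewrite sum_half_pow in H.
(* Truncation at [x] and at [y] costs [PI * (/ 2) ^ J] each. The truncated weights sum to only
   [2 - (/ 2) ^ J], but the missing slope multiplies [y - x >= 0] and has the favourable sign. *)
generalize (fejer_series_close n J x) (fejer_series_close n J y) (half_pow_pos J); intros Hx Hy Hp.
apply Rabs_le_between in Hx; apply Rabs_le_between in Hy.
nra.
Qed.

Lemma in_VT_of_incr (h : R -> R) :
  (forall t, h (t + 2 * PI) = h t) ->
  (forall x y, x <= y -> h x + x <= h y + y) ->
  in_VT (fun t => RtoC (h t)).
Proof.
intros Hp Hi; split; [intros t; now rewrite Hp|].
(* Since h + t and t are nondecreasing, each |increment of h| is at most the increment of h + 2t.
   These telescope to at most the increment of h + 2t over a full period, which is 4 pi as h(0) =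
   h(2 pi). *)
exists (4 * PI); intros n x H0 Hn Hx.
assert (Hs : forall m, (m <= n)%nat ->
  sum_n (fun i => Cmod (RtoC (h (x (S i))) - RtoC (h (x i)))%C) m
  <= (h (x (S m)) + 2 * x (S m)) - (h (x 0%nat) + 2 * x 0%nat)).
{ assert (Hd : forall i, (i <= n)%nat -> Cmod (RtoC (h (x (S i))) - RtoC (h (x i)))%C
    <= (h (x (S i)) + 2 * x (S i)) - (h (x i) + 2 * x i)).
  { intros i Hin; rewrite <- RtoC_minus, Cmod_R.
    generalize (Hi _ _ (Hx i Hin)) (Hx i Hin); intros; apply Rabs_le; lra. }
  intros m Hm; rewrite sum_n_Reals; induction m as [|m IH]; [now apply Hd|].
  rewrite tech5; generalize (IH ltac:(lia)) (Hd (S m) Hm); lra. }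
eapply Rle_trans; [apply Hs; lia|].
generalize (Hi _ _ H0) (Hi _ _ Hn) (Hp 0); rewrite Rplus_0_l; intros; lra.
Qed.

(** * Partial sums at 0 of the product *)

Lemma partial_sum_0_sin_fejer (n M N : nat) :
  partial_sum_0 (fun t => sin (IZR (Z.of_nat n) * t) * fejer_sawtooth M t) N
  = sum_f_R0 (fun i => (/ INR (S i) - / INR (S (S M)))
      * partial_sum_0 (fun t => sin (IZR (Z.of_nat n) * t) * sin (IZR (Z.of_nat (S i)) * t)) N) M.
Proof.
assert (Hc : forall i t, continuous
  (fun t => sin (IZR (Z.of_nat n) * t) * sin (IZR (Z.of_nat (S i)) * t)) t).
{ intros; apply continuous_Rmult; apply continuous_sin_scal. }
rewrite (partial_sum_0_ext _ (fun t => sum_f_R0 (fun i => (/ INR (S i) - / INR (S (S M)))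
  * (sin (IZR (Z.of_nat n) * t) * sin (IZR (Z.of_nat (S i)) * t))) M)).
- rewrite partial_sum_0_sum.
  + apply sum_eq; intros i _; apply partial_sum_0_scal, Hc.
  + intros i t; apply (continuous_Rmult (fun _ => _)); [apply continuous_const|apply Hc].
- intros t; unfold fejer_sawtooth; rewrite scal_sum.
  apply sum_eq; intros i _; rewrite INR_IZR_INZ; ring.
Qed.

Lemma partial_sum_0_sin_fejer_pos (n M N : nat) :
  0 <= partial_sum_0 (fun t => sin (IZR (Z.of_nat n) * t) * fejer_sawtooth M t) N.
Proof.
rewrite partial_sum_0_sin_fejer.
rewrite <- (Rmult_0_l (INR (S M))), <- sum_cte.
apply sum_Rle; intros i Hi; apply Rmult_le_pos; [now apply fejer_sawtooth_coef_pos|].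
(* For nonnegative frequencies |n - p| <= n + p, so the subtracted indicator is 1 only when the
   first one is. *)
rewrite partial_sum_0_sin_sin; repeat destruct Z_le_dec; lia || lra.
Qed.

Lemma partial_sum_0_sin_fejer_diag (n : nat) :
  (1 <= n)%nat ->
  (ln (INR n) - 1) / 2
  <= partial_sum_0 (fun t => sin (IZR (Z.of_nat n) * t) * fejer_sawtooth n t) n.
Proof.
intros Hn; rewrite partial_sum_0_sin_fejer.
rewrite (sum_eq _ (fun i => (/ INR (S i) - / INR (S (S n))) * / 2)).
- rewrite <- scal_sum.
  generalize (fejer_sawtooth_coef_sum n); intros.
  assert (ln (INR n) <= ln (INR (S (S n)))).
  { apply ln_le; [apply lt_0_INR; lia|apply le_INR; lia]. }
  lra.
- intros i Hi; rewrite partial_sum_0_sin_sin.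
  (* Here p = [S i] runs from 1 to n + 1, which is at most 2n because n >= 1; thus |n - p| <= n < n
     + p. *)
  destruct (Z_le_dec (Z.abs (Z.of_nat n - Z.of_nat (S i)))); [|lia].
  destruct (Z_le_dec (Z.abs (Z.of_nat n + Z.of_nat (S i)))); [lia|]; ring.
Qed.

Lemma partial_sum_0_product_sum (a : nat -> R) (n : nat -> nat) (J N : nat) :
  partial_sum_0 (fun t => sine_sum a n J t * fejer_sum n J t) N
  = sum_f_R0 (fun i => a i * sum_f_R0 (fun l => (/ 2) ^ l *
      partial_sum_0 (fun t => sin (IZR (Z.of_nat (n i)) * t) * fejer_sawtooth (n l) t) N) J) J.
Proof.
assert (Hc : forall i l t, continuous
  (fun t => sin (IZR (Z.of_nat (n i)) * t) * fejer_sawtooth (n l) t) t).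
{ intros; apply continuous_Rmult; [apply continuous_sin_scal|apply fejer_sawtooth_continuous]. }
assert (Hc1 : forall i l t, continuous
  (fun t => (/ 2) ^ l * (sin (IZR (Z.of_nat (n i)) * t) * fejer_sawtooth (n l) t)) t).
{ intros; apply (continuous_Rmult (fun _ => _)); [apply continuous_const|apply Hc]. }
assert (Hc2 : forall i t, continuous (fun t => sum_f_R0 (fun l =>
  (/ 2) ^ l * (sin (IZR (Z.of_nat (n i)) * t) * fejer_sawtooth (n l) t)) J) t).
{ intros i t; apply (continuous_sum_f_R0 (fun l t => _)); intros l; apply Hc1. }
rewrite (partial_sum_0_ext _ (fun t => sum_f_R0 (fun i => a i * sum_f_R0 (fun l =>
  (/ 2) ^ l * (sin (IZR (Z.of_nat (n i)) * t) * fejer_sawtooth (n l) t)) J) J)).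
- rewrite (partial_sum_0_sum (fun i t => _)).
  + apply sum_eq; intros i _; rewrite partial_sum_0_scal by apply Hc2; f_equal.
    rewrite (partial_sum_0_sum (fun l t => _)) by apply Hc1.
    apply sum_eq; intros l _; apply partial_sum_0_scal, Hc.
  + intros i t; apply (continuous_Rmult (fun _ => _)); [apply continuous_const|apply Hc2].
- intros t; unfold sine_sum, fejer_sum.
  rewrite Rmult_comm, scal_sum; apply sum_eq; intros i _.
  rewrite Rmult_assoc; f_equal; rewrite scal_sum; apply sum_eq; intros l _; ring.
Qed.

(** A double sum of nonnegative terms dominates its (j, j) term. The bound does not depend on [J],
    so it survives the limit in [J]. *)
Lemma partial_sum_0_product_sum_ge (a : nat -> R) (n : nat -> nat) (j J : nat) :
  (forall i, 0 <= a i) -> (j <= J)%nat -> (1 <= n j)%nat ->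
  a j * (/ 2) ^ j * ((ln (INR (n j)) - 1) / 2)
  <= partial_sum_0 (fun t => sine_sum a n J t * fejer_sum n J t) (n j).
Proof.
intros Ha HJ Hn; rewrite partial_sum_0_product_sum.
set (T i l := (/ 2) ^ l *
  partial_sum_0 (fun t => sin (IZR (Z.of_nat (n i)) * t) * fejer_sawtooth (n l) t) (n j)).
assert (HT : forall i l, 0 <= T i l).
{ intros; apply Rmult_le_pos; [left; apply half_pow_pos|apply partial_sum_0_sin_fejer_pos]. }
apply Rle_trans with (a j * sum_f_R0 (T j) J).
- rewrite Rmult_assoc; apply Rmult_le_compat_l; [apply Ha|].
  apply Rle_trans with (T j j).
  + apply Rmult_le_compat_l; [left; apply half_pow_pos|now apply partial_sum_0_sin_fejer_diag].
  + now apply (sum_f_R0_ge_term (T j)).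
- apply (sum_f_R0_ge_term (fun i => a i * sum_f_R0 (T i) J)); [|assumption].
  intros i; apply Rmult_le_pos; [apply Ha|now apply cond_pos_sum].
Qed.

(** Write fg - f_J g_J = f (g - g_J) + (f - f_J) g_J. Comparison with the truncations at index 0
    gives |f| <= 2 and |g| <= 2 pi, hence |g_J| <= 3 pi; so 5 pi = 2 pi + 3 pi. *)
Lemma product_close (a : nat -> R) (n : nat -> nat) (J : nat) (t : R) :
  (forall j, 0 <= a j <= (/ 2) ^ j) ->
  Rabs (sine_series a n t * fejer_series n t - sine_sum a n J t * fejer_sum n J t)
  <= 5 * PI * (/ 2) ^ J.
Proof.
intros Ha.
assert (HPI := PI_RGT_0).
assert (Hf0 := sine_series_close a n 0 t Ha).
assert (HfJ := sine_series_close a n J t Ha).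
assert (Hg0 := fejer_series_close n 0 t).
assert (HgJ := fejer_series_close n J t).
assert (Hp := half_pow_pos J).
assert (Hp1 : (/ 2) ^ J <= 1).
{ rewrite <- (pow1 J); apply pow_incr; lra. }
assert (Hu : Rabs (sine_sum a n 0 t) <= 1).
{ unfold sine_sum; simpl; destruct (Ha 0%nat) as [H1 H2]; simpl in H2.
  rewrite Rabs_mult, Rabs_right by lra.
  assert (Hs : Rabs (sin (IZR (Z.of_nat (n 0%nat)) * t)) <= 1) by apply Rabs_le, SIN_bound.
  generalize (Rabs_pos (sin (IZR (Z.of_nat (n 0%nat)) * t))); nra. }
assert (Hv : Rabs (fejer_sum n 0 t) <= PI).
{ assert (H := fejer_term_bound n 0 t); rewrite pow_O, Rmult_1_r in H; exact H. }
rewrite pow_O, Rmult_1_r in Hf0, Hg0; rewrite Rmult_1_l in HfJ.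
assert (Hf : Rabs (sine_series a n t) <= 2).
{ generalize (Rabs_triang_inv (sine_series a n t) (sine_sum a n 0 t)); lra. }
assert (Hg : Rabs (fejer_sum n J t) <= 3 * PI).
{ generalize (Rabs_triang_inv (fejer_series n t) (fejer_sum n 0 t)).
  generalize (Rabs_triang_inv (fejer_sum n J t) (fejer_series n t)).
  rewrite Rabs_minus_sym; nra. }
replace (_ - _) with (sine_series a n t * (fejer_series n t - fejer_sum n J t)
  + (sine_series a n t - sine_sum a n J t) * fejer_sum n J t) by ring.
eapply Rle_trans; [apply Rabs_triang|]; rewrite !Rabs_mult.
replace (5 * PI * (/ 2) ^ J) with (2 * (PI * (/ 2) ^ J) + (/ 2) ^ J * (3 * PI)) by ring.
apply Rplus_le_compat; apply Rmult_le_compat; auto using Rabs_pos.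
Qed.

(** A zero lower limit provides arbitrarily large m with gamma(m) / ln m < 4^-j, so m can also be
    taken beyond exp(2 * 4^j). The condition [j <= n j] lets [n j] pass any threshold. *)
Lemma frequency_choice (gamma : nat -> R) :
  LimInf_seq (fun n : nat => gamma n / ln (INR n)) = Finite 0 ->
  exists n : nat -> nat, forall j,
    (1 <= n j)%nat /\ (j <= n j)%nat /\ 2 * 4 ^ j <= ln (INR (n j)) /\
    gamma (n j) <= (/ 4) ^ j * ln (INR (n j)).
Proof.
intros H.
assert (Hl : is_LimInf_seq (fun n : nat => gamma n / ln (INR n)) 0).
{ rewrite <- H; unfold LimInf_seq; apply proj2_sig. }
apply (functional_choice (fun j m => (1 <= m)%nat /\ (j <= m)%nat /\
  2 * 4 ^ j <= ln (INR m) /\ gamma m <= (/ 4) ^ j * ln (INR m))).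
intros j.
assert (H4 : 0 < 4 ^ j) by (apply pow_lt; lra).
destruct (INR_unbounded (exp (2 * 4 ^ j))) as [N0 HN0].
assert (Hq : 0 < (/ 4) ^ j) by (apply pow_lt; lra).
destruct (Hl (mkposreal _ Hq)) as [Hinf _].
destruct (Hinf (max 1 (max j N0))) as [m [Hm Hlt]]; simpl in Hlt.
assert (Hln : 2 * 4 ^ j <= ln (INR m)).
{ rewrite <- (ln_exp (2 * 4 ^ j)); apply ln_le; [apply exp_pos|].
  apply Rle_trans with (INR N0); [lra|apply le_INR; lia]. }
exists m; repeat split; try lia; [exact Hln|].
rewrite Rplus_0_l in Hlt.
(* Clearing the denominator is sound because [Hln] makes the logarithm positive, which rules out m =
   1, where the quotient is a division by 0. *)
apply Rmult_lt_compat_r with (r := ln (INR m)) in Hlt; [|lra].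
replace (gamma m / ln (INR m) * ln (INR m)) with (gamma m) in Hlt by (field; lra).
lra.
Qed.

Theorem theorem4
  (gamma : nat -> R)
  (gamma_pos : forall n : nat, 0 < gamma n)
  (gamma_inf : Rbar_lt 0 (Inf_seq (fun n : nat => Finite (gamma n))))
  (gamma_log : LimInf_seq (fun n : nat => gamma n / ln (INR n)) = Finite 0) :
  exists f g : R -> R,
    in_AT gamma (fun t : R => RtoC (f t)) /\
    in_VT (fun t : R => RtoC (g t)) /\
    in_CT (fun t : R => RtoC (g t)) /\
    ~ in_UT (fun t : R => RtoC (f t * g t)).
Proof.
destruct (frequency_choice gamma gamma_log) as [n Hn].
(* The scaling makes [a j * (/ 2) ^ j * ln (INR (n j))] equal to 1, while both [a j] and
   [a j * gamma (n j)] stay below [(/ 2) ^ j] by the choice of [n j]. *)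
set (a j := 2 ^ j / ln (INR (n j))).
assert (Hln : forall j, 0 < ln (INR (n j))).
{ intros j; destruct (Hn j) as [_ [_ [H _]]].
  assert (0 < 4 ^ j) by (apply pow_lt; lra); lra. }
assert (H2 : forall j, 0 < 2 ^ j) by (intros; apply pow_lt; lra).
assert (H42 : forall j, (/ 2) ^ j * 4 ^ j = 2 ^ j).
{ intros j; rewrite <- Rpow_mult_distr; f_equal; field. }
assert (H24 : forall j, 2 ^ j * (/ 4) ^ j = (/ 2) ^ j).
{ intros j; rewrite <- Rpow_mult_distr; f_equal; field. }
assert (Ha0 : forall j, 0 <= a j).
{ intros j; left; now apply Rdiv_lt_0_compat. }
assert (Haln : forall j, a j * ln (INR (n j)) = 2 ^ j).
{ intros j; unfold a; field; apply Rgt_not_eq, Hln. }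
assert (Ha : forall j, 0 <= a j <= (/ 2) ^ j).
{ intros j; split; [apply Ha0|].
  destruct (Hn j) as [_ [_ [H _]]].
  apply Rmult_le_reg_r with (ln (INR (n j))); [apply Hln|].
  rewrite Haln, <- H42.
  apply Rmult_le_compat_l; [left; apply half_pow_pos|].
  assert (0 < 4 ^ j) by (apply pow_lt; lra); lra. }
assert (Hag : forall j, a j * gamma (n j) <= (/ 2) ^ j).
{ intros j; destruct (Hn j) as [_ [_ [_ H]]].
  rewrite <- H24, <- (Haln j), Rmult_assoc.
  apply Rmult_le_compat_l; [apply Ha0|lra]. }
assert (Hfc := sine_series_continuous a n Ha).
assert (Hgc := fejer_series_continuous n).
exists (sine_series a n), (fejer_series n); split; [|split; [|split]].
- now apply sine_series_in_AT.
- apply in_VT_of_incr; [apply fejer_series_periodic|apply fejer_series_incr].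
- apply in_CT_RtoC; [apply Hgc|apply fejer_series_periodic].
- intros HU.
  assert (Hc : forall t, continuous (fun t => sine_series a n t * fejer_series n t) t).
  { intros; now apply continuous_Rmult. }
  assert (H0 : sine_series a n 0 * fejer_series n 0 = 0).
  { replace (sine_series a n 0) with 0; [ring|].
    transitivity (Series (fun _ => 0 * 0)); [rewrite Series_scal_l; ring|].
    apply Series_ext; intros j; rewrite (Rmult_0_r (IZR (Z.of_nat _))), sin_0; ring. }
  (* The threshold supplied by uniform convergence is itself taken as the index [j]; [j <= n j] then
     makes the order [n j] admissible. *)
  destruct (in_UT_partial_sum_0 _ (/ 4) Hc H0 ltac:(lra) HU) as [j HN].
  destruct (Hn j) as [Hn1 [Hnj [Hlnj _]]].
  specialize (HN (n j) Hnj).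
  apply (Rlt_not_le _ _ HN).
  (* The order [n j] is frozen and only the truncation [J] grows, so the number of coefficients
     enters as a constant. *)
  apply (le_of_half_pow _ _ (sum_sym (fun _ => 1) (n j) * (5 * PI)) j); intros J HJ.
  rewrite Rmult_assoc.
  eapply Rle_trans; [|apply (partial_sum_0_close (fun t => sine_sum a n J t * fejer_sum n J t))].
  + eapply Rle_trans; [|apply partial_sum_0_product_sum_ge]; auto.
    assert (E : a j * (/ 2) ^ j * ln (INR (n j)) = 1).
    { rewrite Rmult_assoc, (Rmult_comm ((/ 2) ^ j)), <- Rmult_assoc, Haln.
      rewrite <- Rpow_mult_distr; replace (2 * / 2) with 1 by field; apply pow1. }
    assert (Hl2 : 2 <= ln (INR (n j))).
    { assert (1 <= 4 ^ j) by (apply pow_R1_Rle; lra); lra. }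
    assert (0 <= a j * (/ 2) ^ j) by (apply Rmult_le_pos; [apply Ha0|left; apply half_pow_pos]).
    (* With x = a_j 2^-j and L = ln n_j: xL = 1 and L >= 2 give x <= 1/2, so x (L - 1) / 2 = (1 - x)
       / 2 >= 1/4. *)
    nra.
  + intros; apply continuous_Rmult; [apply sine_sum_continuous|apply fejer_sum_continuous].
  + exact Hc.
  + intros t; rewrite Rabs_minus_sym; now apply product_close.
Qed.
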